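(* Fix an integer $q \ge 2$, and let $t = t(n)$ be any function taking positive integer values with $t(n) \le 10\sqrt{n}$ for all $n$. Then the number of $q$-ary $t$-error correcting codes of length $n$ is at most $2^{(1+o(1)) H_q(n,t)}$, where $o(1)$ denotes a quantity tending to $0$ as $n \to \infty$.
   Context: For integers $q\ge 2$, $n \ge 1$, $t \ge 0$: a $q$-ary $t$-error correcting code of length $n$ is a subset of $[q]^n=\{1,\dots,q\}^n$ whose elements pairwise differ in at least $2t+1$ coordinates (the empty set and singletons count as codes). The Hamming distance $d(x,y)$ between $x,y\in[q]^n$ is the number of coordinates in which they differ. $V_q(n,r) = \sum_{i=0}^{r}\binom{n}{i}(q-1)^i$ is the cardinality of a Hamming ball of radius $r$ in $[q]^n$, and $H_q(n,t) = q^n / V_q(n,t)$ (the Hamming bound). *)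

(* Defs.v *)
From mathcomp Require Import all_boot.
From Stdlib Require Import Reals.

Set Implicit Arguments. Unset Strict Implicit. Unset Printing Implicit Defensive.

Definition word (q n : nat) := {ffun 'I_n -> 'I_q}.

Definition hamming (q n : nat) (x y : word q n) : nat :=
  #|[pred i : 'I_n | x i != y i]|.

Definition is_code (q n t : nat) (C : {set word q n}) : bool :=
  [forall x in C, forall y in C, (x != y) ==> (2 * t + 1 <= hamming x y)].

Definition num_codes (q n t : nat) : nat :=
  #|[set C : {set word q n} | is_code t C]|.

Definition Vball (q n r : nat) : nat :=
  \sum_(i < r.+1) 'C(n, i) * (q - 1) ^ i.

Definition Hbound (q n t : nat) : R :=
  (INR (q ^ n) / INR (Vball q n t))%R.

(* Main.v *)
(* Let F(A) be the number of codes contained in a set A of words. Splitting on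
   whether a word x of A is in the code gives F(A) <= F(A - x) + F(A - x - N(x)),
   where N(x) is the set of words of A too close to x. Hence
   log2 F(A) <= sum_(m <= |A|) w(m) for any nonincreasing w such that every A of
   size m has a word x with 2^-w(m) + 2^-(w(m) (|N(x)| + 1)) <= 1. We take w = 1
   up to (1 + eta) H, and w(m) = H / (n^(1/4) m), then H / (n^(3/2) m), beyond:
   all but the first range contribute o(H) in total.

   Large degrees come from supersaturation. Counting with Cauchy-Schwarz how often
   each word is covered by the radius-t balls around the words of A, some x in A
   has sum_(y in A) |B(x) :&: B(y)| >= V |A| / H. Balls with centres at distance at
   least 2k - 1 share at most 2 q^(2k-1) V(t-k) = O(V n^(-k/2)) words, because
   t = O(sqrt n), so many y must contribute. One uses k = 1 for
   (1 + eta) H <= |A| <= n^12 H and k = 6 for larger A. *)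
Require Import Defs.
From Stdlib Require Import Reals Lra.
From mathcomp Require Import all_boot.
From mathcomp Require Import ssrZ zify_ssreflect.

Set Implicit Arguments. Unset Strict Implicit. Unset Printing Implicit Defensive.

(** * Hamming spheres and balls: exact cardinalities *)

Lemma pow_expn m n : Nat.pow m n = m ^ n.
Proof. by elim: n => // n IH; rewrite expnS -IH. Qed.

(* Radii are strict: vol q n r counts the words at distance < r, so that a
   negative radius t - k becomes the empty ball of vol q n (t.+1 - k). *)
Definition vol (q n r : nat) : nat := \sum_(i < r) 'C(n, i) * (q - 1) ^ i.

Definition ball (q n r : nat) (x : word q n) : {set word q n} :=
  [set z | hamming x z < r].

Lemma hammingE q n (x y : word q n) : hamming x y = #|[set i | x i != y i]|.
Proof. by rewrite cardsE. Qed.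

Lemma hamming_sym q n (x y : word q n) : hamming x y = hamming y x.
Proof. by apply: eq_card => i; rewrite !inE eq_sym. Qed.

Lemma hamming_triangle q n (x y z : word q n) :
  hamming x y <= hamming x z + hamming z y.
Proof.
rewrite /hamming -cardUI; apply: leq_trans (leq_addr _ _).
apply/subset_leq_card/subsetP => i; rewrite !inE.
by case: (x i =P z i) => [->|].
Qed.

Lemma hamming_id q n (x : word q n) : hamming x x = 0.
Proof. by apply: eq_card0 => i; rewrite !inE eqxx. Qed.

Lemma card_family_prod (aT rT : finType) (F : aT -> pred rT) :
  #|family F| = \prod_i #|F i|.
Proof. by rewrite card_family foldrE big_map big_enum. Qed.

Lemma prod_if_mem (T : finType) (D : {set T}) (a : nat) :
  \prod_i (if i \in D then a else 1) = a ^ #|D|.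
Proof. by rewrite -big_mkcond prod_nat_const. Qed.

Lemma card_words_off q n (D : {set 'I_n}) (x : word q n) :
  #|[set z : word q n | [forall i, (i \notin D) ==> (z i == x i)]]| = q ^ #|D|.
Proof.
pose F i : pred 'I_q := if i \in D then predT else pred1 (x i).
have -> : q ^ #|D| = \prod_i #|F i|.
  rewrite -prod_if_mem; apply: eq_bigr => i _.
  by rewrite /F; case: ifP; rewrite ?card1 // card_ord.
rewrite -card_family_prod; apply: eq_card => z; rewrite inE.
apply/forallP/familyP => h i; have := h i; rewrite /F;
  by case: (i \in D); rewrite ?inE.
Qed.

(** Such a [z] is a free choice, at each coordinate of [D], of one of the [q - 1] letters other than
    that of [x]. Summing over all [D] of a given size yields the sphere sizes. *)
Lemma card_words_support q n (D : {set 'I_n}) (x : word q n) :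
  #|[set z : word q n | [set i | x i != z i] == D]| = (q - 1) ^ #|D|.
Proof.
pose F i : pred 'I_q := if i \in D then predC1 (x i) else pred1 (x i).
have -> : (q - 1) ^ #|D| = \prod_i #|F i|.
  rewrite -prod_if_mem; apply: eq_bigr => i _; rewrite /F; case: ifP; rewrite ?card1 // => _.
  by have := cardC1 (x i); rewrite card_ord -subn1.
rewrite -card_family_prod; apply: eq_card => z; rewrite inE.
apply/eqP/familyP => [eD i|h].
  by rewrite /F -eD inE; case: (x i =P z i) => [->|/eqP]; rewrite !inE // eq_sym.
apply/setP => i; have := h i; rewrite /F !inE; case: (i \in D); rewrite inE.
  by rewrite eq_sym.
by move/eqP->; rewrite eqxx.
Qed.

Lemma card_sphere q n (x : word q n) i :
  #|[set z | hamming x z == i]| = 'C(n, i) * (q - 1) ^ i.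
Proof.
have card_supp (z : word q n) : #|[set j | x j != z j]| = hamming x z.
  by rewrite cardsE.
rewrite -sum1_card
  (partition_big (fun z : word q n => [set j | x j != z j]) (fun D => #|D| == i)) /=.
  rewrite -[in RHS](card_ord n) -card_draws -sum_nat_const.
  apply: eq_big => [D|D /eqP <-]; first by rewrite inE.
  rewrite sum1_card -(card_words_support D x); apply: eq_card => z.
  rewrite !inE; apply/andP/idP => [[]//|h]; split=> //.
  by rewrite inE -card_supp (eqP h).
by move=> z; rewrite inE card_supp.
Qed.

Lemma card_ball q n r (x : word q n) : #|ball r x| = vol q n r.
Proof.
elim: r => [|r IH]; first by rewrite /vol big_ord0; apply: eq_card0 => z; rewrite inE.
rewrite /vol big_ord_recr /= -/(vol q n r) -IH -(card_sphere x r).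
rewrite -cardsUI [X in _ + X]eq_card0 ?addn0 => [|z]; last first.
  by rewrite !inE; apply/negP; lia.
by apply: eq_card => z; rewrite !inE; lia.
Qed.

Lemma VballE q n t : Vball q n t = vol q n t.+1.
Proof. by apply: eq_bigr => i _; rewrite pow_expn. Qed.

Lemma card_word q n : #|{: word q n}| = q ^ n.
Proof. by rewrite card_ffun !card_ord. Qed.

(** * Overlaps of balls and supersaturation *)

Lemma sqr_sum_le (T : finType) (f : T -> nat) :
  (\sum_z f z) ^ 2 <= #|T| * \sum_z f z ^ 2.
Proof.
rewrite -(leq_pmul2l (isT : 0 < 2)).
have -> : 2 * (#|T| * \sum_z f z ^ 2) = \sum_z \sum_w (f z ^ 2 + f w ^ 2).
  transitivity (\sum_z (#|T| * f z ^ 2 + \sum_w f w ^ 2)).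
    by rewrite big_split -big_distrr sum_nat_const /= addnn -mul2n.
  by apply: eq_bigr => z _; rewrite [RHS]big_split sum_nat_const.
rewrite expnS expn1 big_distrlr /= big_distrr /=; apply: leq_sum => z _.
by rewrite big_distrr /=; apply: leq_sum => w _; exact: nat_Cauchy.
Qed.

(** Let [f z] count the sets [B x], [x] in [S], that contain [z]. Its sum is [#|S| * v] and its sum
    of squares is the total of all pairwise overlaps, which Cauchy-Schwarz bounds from below; some
    [x] reaches the average. *)
Lemma heavy_overlap (T U : finType) (B : T -> {set U}) (v : nat) (S : {set T}) :
  S != set0 -> (forall x, #|B x| = v) ->
  exists2 x, x \in S & #|S| * v ^ 2 <= #|U| * \sum_(y in S) #|B x :&: B y|.
Proof.
move=> /set0Pn[x0 x0S] cardB.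
pose f z := \sum_(x in S) (z \in B x : nat).
have sumf : \sum_z f z = #|S| * v.
  rewrite /f exchange_big -sum_nat_const; apply: eq_bigr => x _.
  by rewrite -(cardB x) -sum1_card [RHS]big_mkcond; apply: eq_bigr => z _; case: (z \in _).
have sumf2 : \sum_z f z ^ 2 = \sum_(x in S) \sum_(y in S) #|B x :&: B y|.
  under eq_bigr do rewrite /f expnS expn1 big_distrlr /=.
  rewrite exchange_big /=; apply: eq_bigr => x _; rewrite exchange_big /=.
  apply: eq_bigr => y _; rewrite -sum1_card [RHS]big_mkcond; apply: eq_bigr => z _.
  by rewrite inE; case: (z \in _); case: (z \in _).
have := sqr_sum_le f; rewrite sumf sumf2 => le2.
have [|/exists_inPn h] := boolP [exists x in S, #|S| * v ^ 2 <= #|U| * \sum_(y in S) #|B x :&: B y|].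
  by case/exists_inP => x; exists x.
suff : #|U| * (\sum_(x in S) \sum_(y in S) #|B x :&: B y|) < (#|S| * v) ^ 2.
  by rewrite ltnNge le2.
have -> : (#|S| * v) ^ 2 = \sum_(x in S) #|S| * v ^ 2 by rewrite sum_nat_const; lia.
rewrite big_distrr /= (bigD1 x0) //= [X in _ < X](bigD1 x0) //=.
rewrite -addSn leq_add //; first by rewrite ltnNge h.
by apply: leq_sum => x /andP[xS _]; apply: ltnW; rewrite ltnNge h.
Qed.

(** Encode [z] by its letters on [D], with [q ^ #|D|] possibilities, and by the word obtained from
    [z] by copying [x] on [D]. The second word is at least [k] closer to [x], so it lies in the ball
    of [vol q n (t - k)]. *)
Lemma card_ball_far q n t k (D : {set 'I_n}) (x : word q n) :
  #|[set z | (hamming x z < t) && (k <= #|[set i in D | x i != z i]|)]|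
    <= q ^ #|D| * vol q n (t - k).
Proof.
pose u (z : word q n) : word q n := [ffun i => if i \in D then z i else x i].
pose w (z : word q n) : word q n := [ffun i => if i \in D then x i else z i].
have inj : injective (fun z => (u z, w z)).
  move=> z1 z2 [] /ffunP hu /ffunP hw; apply/ffunP => i.
  by move: (hu i) (hw i); rewrite !ffunE; case: ifP.
rewrite -(card_words_off D x) -(card_ball _ x) -cardsX -(card_imset _ inj).
apply/subset_leq_card/subsetP => p /imsetP[z]; rewrite !inE => /andP[hz kz] ->.
apply/andP; split; first by apply/forallP => i; apply/implyP; rewrite ffunE => /negbTE ->.
suff e : hamming x (w z) + #|[set i in D | x i != z i]| = hamming x z.
  by rewrite /= ltn_subRL addnC; apply: leq_ltn_trans hz; rewrite -e leq_add2l.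
rewrite !hammingE -cardsUI.
rewrite [X in _ + X]eq_card0 ?addn0 => [|i]; last first.
  by rewrite !inE ffunE; case: (i \in D); rewrite ?eqxx ?andbF.
by apply: eq_card => i; rewrite !inE ffunE; case: (i \in D); rewrite ?eqxx ?orbF.
Qed.

(* Among 2k - 1 coordinates where x and y differ, any z differs from x or from y
   in at least k of them. *)
Lemma card_ballI q n t k (x y : word q n) : 2 * k - 1 <= hamming x y ->
  #|ball t x :&: ball t y| <= 2 * q ^ (2 * k - 1) * vol q n (t - k).
Proof.
rewrite hammingE => le_k.
have [D subD cardD] : exists2 D : {set 'I_n}, D \subset [set i | x i != y i] & #|D| = 2 * k - 1.
  have [s [us <- sub]] := card_geqP le_k; exists [set i in s].
    by apply/subsetP => i; rewrite inE => /sub.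
  by rewrite cardsE (card_uniqP us).
rewrite -cardD -mulnA mul2n -addnn.
apply: leq_trans (leq_add (card_ball_far t k D x) (card_ball_far t k D y)).
rewrite -cardsUI; apply: leq_trans (leq_addr _ _).
apply/subset_leq_card/subsetP => z; rewrite !inE => /andP[-> ->] /=.
apply/orP; suff : #|D| <= #|[set i in D | x i != z i]| + #|[set i in D | y i != z i]|.
  rewrite cardD; move: #|_| #|_| => a b; lia.
rewrite -cardsUI; apply: leq_trans (leq_addr _ _).
apply/subset_leq_card/subsetP => i iD; rewrite !inE iD /=.
have := subsetP subD i iD; rewrite inE.
by case: (x i =P z i) => [->|//]; rewrite eq_sym.
Qed.

Lemma ballI_far q n t (x y : word q n) : 2 * t < hamming x y ->
  ball t.+1 x :&: ball t.+1 y = set0.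
Proof.
move=> h; apply/setP => z; rewrite !inE; apply/negP => /andP[hx hy].
have := hamming_triangle x y z; rewrite (hamming_sym z y); lia.
Qed.

(** In the overlap sum of a heavy [x], the words at distance below [2 * k - 1] get the trivial
    bound, a full ball each. Among the others only the conflicting ones have a nonempty overlap, and
    [card_ballI] makes it small. *)
Lemma supersaturation q n t k (S : {set word q n}) : 0 < k -> S != set0 ->
  exists2 x, x \in S &
    #|S| * vol q n t.+1 ^ 2 <= q ^ n *
      (vol q n (2 * k - 1) * vol q n t.+1
       + #|[set y in S | (y != x) && ~~ (2 * t + 1 <= hamming x y)]|
         * (2 * q ^ (2 * k - 1) * vol q n (t.+1 - k))).
Proof.
move=> k0 S0; have [x xS hx] := heavy_overlap S0 (@card_ball q n t.+1).
exists x => //; rewrite card_word in hx; apply: leq_trans hx _.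
rewrite leq_mul2l; apply/orP; right.
rewrite (bigID (mem (ball (2 * k - 1) x))) /=; apply: leq_add.
  rewrite -(card_ball (2 * k - 1) x) -sum_nat_const big_mkcond [X in _ <= X]big_mkcond /=.
  apply: leq_sum => y _; case: ifP => [/andP[_ ->]|_]; last by [].
  by rewrite -(card_ball t.+1 x) subset_leq_card // subsetIl.
rewrite -sum_nat_const big_mkcond [X in _ <= X]big_mkcond /=.
apply: leq_sum => y _; case: ifP => [/andP[yS]|//]; rewrite !inE -leqNgt => far.
rewrite yS /=; case: ifP => [_|/negbT]; first exact: card_ballI.
rewrite negb_and !negbK => /orP[/eqP yx|].
  (* Since [k] is positive, [2 * k - 1] is at least 1, so [x] itself is among the near words. *)
  by move: far; rewrite yx hamming_id; lia.
by rewrite addn1 => /ballI_far ->; rewrite cards0.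
Qed.

(** * Growth of ball volumes *)

(** Compare the term of index [i] on the left with the term of index [i + 1] on the right: their
    binomials have ratio [(i + 1) / (n - i)], where [i + 1 <= r] and [n - i >= n - r]. The term of
    index 0 on the right is dropped. *)
Lemma vol_ratio q n r : 1 < q -> vol q n r * (n - r) <= r * vol q n r.+1.
Proof.
move=> q1; rewrite /vol big_ord_recl big_distrl mulnDr big_distrr /=.
apply: leq_trans (leq_addl _ _); apply: leq_sum => i _; rewrite /bump /= add1n.
have := mul_bin_left n i; have := ltn_ord i => ir e.
have -> : r * ('C(n, i.+1) * (q - 1) ^ i.+1) = (r * 'C(n, i.+1)) * (q-1) * (q - 1) ^ i.
  by rewrite expnS; lia.
rewrite -mulnA (mulnC (_ ^ _)) mulnA leq_mul2r; apply/orP; right.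
apply: (@leq_trans (i.+1 * 'C(n, i.+1))); first by rewrite e; nia.
apply: leq_trans (leq_mul ir (leqnn _)) _.
by rewrite leq_pmulr // subn_gt0.
Qed.

Lemma vol_shrink q n t k : 1 < q ->
  vol q n (t.+1 - k) * (n - t) ^ k <= t ^ k * vol q n t.+1.
Proof.
move=> q1; elim: k => [|k IH]; first by rewrite subn0 !expn0 muln1 mul1n.
have [le_tk|lt_kt] := leqP t k.
  (* The radius has run out: the ball on the left is empty. *)
  have -> : t.+1 - k.+1 = 0 by lia.
  by rewrite /vol big_ord0 mul0n.
have := vol_ratio n (t - k) q1.
have -> : t.+1 - k.+1 = t - k by lia.
have e : t.+1 - k = (t - k).+1 by lia.
rewrite e in IH => h.
rewrite !expnS mulnA -(mulnA t); apply: leq_trans (leq_mul (leqnn t) IH).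
rewrite mulnA leq_mul2r; apply/orP; right.
apply: (@leq_trans (vol q n (t - k) * (n - (t - k)))); first by rewrite leq_mul2l; lia.
by apply: leq_trans h _; rewrite leq_mul2r; lia.
Qed.

Lemma bin_le_exp n i : 'C(n, i) <= n ^ i.
Proof.
elim: i => [|i IH]; first by rewrite bin0.
rewrite expnS; apply: leq_trans (leq_mul (leqnn n) IH).
apply: leq_trans (leq_mul (leq_subr i n) (leqnn _)).
by rewrite -mul_bin_left leq_pmull.
Qed.

Lemma vol_le q n r : 0 < q -> 0 < n -> vol q n r.+1 <= r.+1 * (q * n) ^ r.
Proof.
move=> q0 n0; rewrite -{2}(card_ord r.+1) -sum_nat_const; apply: leq_sum => i _.
have ir : i <= r by rewrite -ltnS.
apply: (@leq_trans ((q * n) ^ i)); last by rewrite leq_pexp2l // muln_gt0 q0.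
rewrite expnMn (mulnC (q ^ i)) leq_mul ?bin_le_exp //.
by case: (nat_of_ord i) => // j; rewrite leq_exp2r // leq_subr.
Qed.

(** * Counting independent sets by deleting vertices *)

(** Here [r] is compatibility, the complement of adjacency. The shape copies [is_code], so that
    codes are the independent sets of the relation [far_apart]. *)
Definition indep (T : finType) (r : rel T) (C : {set T}) : bool :=
  [forall x in C, forall y in C, (x != y) ==> r x y].

Definition indep_in (T : finType) (r : rel T) (A : {set T}) : {set {set T}} :=
  [set C : {set T} | (C \subset A) && indep r C].

Definition conflicts (T : finType) (r : rel T) (A : {set T}) (x : T) : {set T} :=
  [set y in A | (y != x) && ~~ r x y].

(** Sets avoiding [x] live in [A :\ x]. For sets containing [x], removing [x] is injective and
    leaves a set free of the conflicts of [x]. *)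
Lemma card_indep_in_split (T : finType) (r : rel T) (A : {set T}) (x : T) :
  #|indep_in r A| <= #|indep_in r (A :\ x)|
                     + #|indep_in r (A :\ x :\: conflicts r A x)|.
Proof.
rewrite -(cardsID [set C : {set T} | x \in C] (indep_in r A)) addnC.
apply: leq_add.
  apply/subset_leq_card/subsetP => C; rewrite !inE => /andP[xC /andP[sub ->]].
  by rewrite andbT subsetD1 sub.
have inj : {in indep_in r A :&: [set C : {set T} | x \in C] &,
            injective (fun C : {set T} => C :\ x)}.
  move=> C D; rewrite !inE => /andP[_ xC] /andP[_ xD] e.
  by rewrite -(setD1K xC) -(setD1K xD) e.
rewrite -(card_in_imset inj).
apply/subset_leq_card/subsetP => _ /imsetP[C + ->].
rewrite !inE => /andP[/andP[/subsetP sub /forall_inP ind] xC].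
apply/andP; split; last first.
  apply/forall_inP => y /setD1P[_ yC]; apply/forall_inP => z /setD1P[_ zC].
  exact: (forall_inP (ind y yC)).
apply/subsetP => y /setD1P[yx yC]; rewrite !inE yx sub //= negbK.
by rewrite andbT; apply: (implyP (forall_inP (ind x xC) y yC)); rewrite eq_sym.
Qed.

(* MathComp rebinds the key %R to ring_scope. *)
Delimit Scope R_scope with R.
Local Open Scope R_scope.

Lemma le_INR_leq (m n : nat) : (m <= n)%N -> INR m <= INR n.
Proof. by move=> /leP; exact: le_INR. Qed.

Lemma INR_addn (m n : nat) : INR (m + n)%N = INR m + INR n.
Proof. exact: plus_INR. Qed.

Lemma INR_muln (m n : nat) : INR (m * n)%N = INR m * INR n.
Proof. exact: mult_INR. Qed.

Lemma INR_expn (m n : nat) : INR (m ^ n)%N = INR m ^ n.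
Proof. by elim: n => // n IH; rewrite expnS INR_muln IH. Qed.

(** The indices run from 1 to [m]: one cost for each size of a nonempty set. *)
Fixpoint psum (f : nat -> R) (m : nat) : R :=
  if m is k.+1 then psum f k + f k.+1 else 0.

Lemma psum_drop (f : nat -> R) (m d : nat) :
  (forall i j, (0 < i)%N -> (i <= j)%N -> f j <= f i) -> (d <= m)%N ->
  psum f (m - d)%N + INR d * f m <= psum f m.
Proof.
move=> f_anti; elim: d => [|d IH] dm; first by rewrite subn0 /=; lra.
have := IH (ltnW dm); have e : (m - d = (m - d.+1).+1)%N by lia.
rewrite S_INR e /= => h.
have := f_anti (m - d.+1).+1 m isT ltac:(lia); lra.
Qed.

(** Induction on the size of [A] along the splitting at [x]. Relative to [psum f #|A|], the two
    branches lose the two exponents in the hypothesis, so their powers of 2 add up to at most the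
    desired one. *)
Lemma card_indep_in_le (T : finType) (r : rel T) (f : nat -> R) :
  (forall i j, (0 < i)%N -> (i <= j)%N -> f j <= f i) ->
  (forall A : {set T}, A != set0 -> exists2 x, x \in A &
     Rpower 2 (- f #|A|)
     + Rpower 2 (- (f #|A| * (INR #|conflicts r A x| + 1))) <= 1) ->
  forall A : {set T}, INR #|indep_in r A| <= Rpower 2 (psum f #|A|).
Proof.
move=> f_anti step A.
elim: {A}_.+1 {-2}A (ltnSn #|A|) => // m IH A cardA.
have [->|A0] := eqVneq A set0.
  rewrite cards0 /= Rpower_O; last by lra.
  rewrite -[1]/(INR 1); apply: le_INR_leq.
  rewrite -(cards1 (set0 : {set T})); apply/subset_leq_card/subsetP => C.
  by rewrite !inE subset0 => /andP[].
have [x xA hx] := step A A0.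
set N := conflicts r A x in hx.
have subN : N \subset A :\ x.
  by apply/subsetP => y; rewrite !inE => /andP[-> /andP[->]].
have cA : #|A| = #|A :\ x|.+1 by rewrite (cardsD1 x A) xA.
have cAN : #|A :\ x :\: N| = (#|A :\ x| - #|N|)%N by rewrite cardsD (setIidPr subN).
have leN := subset_leq_card subN.
have ltA : (#|A :\ x| < m)%N by rewrite -ltnS -cA.
have h1 := IH (A :\ x) ltA.
have h2 := IH (A :\ x :\: N)
  ltac:(rewrite cAN; exact: leq_ltn_trans (leq_subr _ _) ltA).
have := le_INR_leq (card_indep_in_split r A x); rewrite INR_addn -/N => h0.
apply: Rle_trans h0 _; apply: Rle_trans (Rplus_le_compat _ _ _ _ h1 h2) _.
rewrite cAN; set S := psum f #|A|.
have e1 : psum f #|A :\ x| = S + - f #|A| by rewrite /S cA /=; lra.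
(* The word [x] leaves together with its conflicts: [#|N| + 1] terms go, each at least [f #|A|] by
   monotonicity. *)
have le1 : psum f (#|A :\ x| - #|N|)%N <= S + - (f #|A| * (INR #|N| + 1)).
  have := @psum_drop f #|A| #|N|.+1 f_anti; rewrite cA ltnS subSS -cA => /(_ leN).
  by rewrite S_INR -/S; lra.
have := Rle_Rpower 2 _ _ ltac:(lra) le1; rewrite e1 !Rpower_plus.
have : 0 < Rpower 2 S by exact: exp_pos.
nra.
Qed.

(** * The cost function and its total *)

Lemma exp_monotone (x y : R) : x <= y -> exp x <= exp y.
Proof. by case=> [/exp_increasing|->]; lra. Qed.

Lemma ln_monotone (x y : R) : 0 < x -> x <= y -> ln x <= ln y.
Proof. by move=> x0 [/(ln_increasing _ _ x0)|->]; lra. Qed.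

(** The first power is at most [1 - y / 4], because [ln 2 > 1 / 2] and [y <= 1]; the hypothesis on
    [d] brings the second down to [y / 4]. *)
Lemma Rpower2_step (y d : R) : 0 < y <= 1 -> 0 <= d -> ln (4 / y) <= y * d / 2 ->
  Rpower 2 (- y) + Rpower 2 (- (y * (d + 1))) <= 1.
Proof.
move=> y01 d0 hd; have l2 := ln_lt_2.
have h1 : Rpower 2 (- y) <= 1 - y / 4.
  rewrite Rpower_Ropp.
  have h : 1 + y / 2 <= Rpower 2 y.
    rewrite /Rpower; have := exp_ineq1_le (y * ln 2); nra.
  apply: Rle_trans (Rinv_le_contravar _ _ _ h) _; first by lra.
  apply: (Rmult_le_reg_l (1 + y / 2)); first by lra.
  rewrite Rinv_r; nra.
have h2 : Rpower 2 (- (y * (d + 1))) <= y / 4.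
  have -> : y / 4 = / (4 / y) by field; lra.
  rewrite Rpower_Ropp; apply: Rinv_le_contravar.
    by apply: Rdiv_lt_0_compat; lra.
  rewrite -[X in X <= _]exp_ln; last by apply: Rdiv_lt_0_compat; lra.
  rewrite /Rpower; apply: exp_monotone.
  have : 0 <= y * d by nra.
  nra.
lra.
Qed.

(** The weight w of the overview; [num_codes_bound] takes [a = (1 + eta) H] and [b = n ^ 12 H], with
    [c] and [c'] equal to [H / n ^ (1/4)] and [H / n ^ (3/2)]. *)
Definition step_cost (a b c c' : R) (m : nat) : R :=
  if Rle_dec (INR m) a then 1
  else if Rle_dec (INR m) b then c / INR m else c' / INR m.

Lemma ln_succ (m : nat) : (0 < m)%N -> / INR m.+1 <= ln (INR m.+1) - ln (INR m).
Proof.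
move=> m0; have m0' : 0 < INR m by apply: lt_0_INR; apply/ltP.
have hS : INR m.+1 = INR m + 1 := S_INR m.
have h : 0 < INR m / INR m.+1 by apply: Rdiv_lt_0_compat; lra.
have -> : ln (INR m.+1) - ln (INR m) = - ln (INR m / INR m.+1).
  by rewrite /Rdiv ln_mult ?ln_Rinv; [ring | lra | lra | apply: Rinv_0_lt_compat; lra].
have := exp_ineq1_le (ln (INR m / INR m.+1)); rewrite exp_ln //.
have -> : INR m / INR m.+1 = 1 - / INR m.+1 by rewrite hS; field; lra.
lra.
Qed.

Lemma step_cost_anti (a b c c' : R) : 0 <= c' <= c -> c <= a -> a <= b ->
  forall i j, (0 < i)%N -> (i <= j)%N -> step_cost a b c c' j <= step_cost a b c c' i.
Proof.
move=> c'c ca ab i j i0 ij.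
have i0' : 0 < INR i by apply: lt_0_INR; apply/ltP.
have ij' := le_INR_leq ij.
have hinv : / INR j <= / INR i by apply: Rinv_le_contravar.
have j0 : 0 < / INR j by apply: Rinv_0_lt_compat; lra.
have i0'' : 0 < / INR i by apply: Rinv_0_lt_compat; lra.
have le1 u : 0 <= u <= a -> a < INR j -> u / INR j <= 1.
  move=> ua aj; apply: (Rmult_le_reg_r (INR j)); first by lra.
  by rewrite /Rdiv Rmult_assoc Rinv_l; lra.
have le2 u v : 0 <= u <= v -> u / INR j <= v / INR i.
  by move=> uv; apply: Rmult_le_compat; lra.
rewrite /step_cost; case: (Rle_dec (INR j) a) => hj; case: (Rle_dec (INR i) a) => hi;
  case: (Rle_dec (INR j) b) => hj'; case: (Rle_dec (INR i) b) => hi';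
  rewrite /=; try lra; try (apply: le1; lra); apply: le2; lra.
Qed.

(** The sum is at most [a] over the first range and harmonic on the other two, where [ln_succ]
    compares it with logarithms. *)
Lemma psum_step_cost (a b c c' : R) (m : nat) : 0 < a <= b -> 0 <= c -> 0 <= c' ->
  (0 < m)%N ->
  psum (step_cost a b c c') m
    <= a + c * (1 + (ln b - ln a)) + c' * (1 + ln (INR m)).
Proof.
move=> ab c0 c'0 m0.
have lnab : 0 <= ln b - ln a by have := @ln_monotone a b ltac:(lra) ltac:(lra); lra.
have base (k : nat) : INR k <= a -> psum (step_cost a b c c') k <= INR k.
  elim: k => [_|k IH]; first by rewrite /=; lra.
  rewrite S_INR => hk; rewrite /= {2}/step_cost S_INR.
  case: (Rle_dec (INR k + 1) a) => [?|?] /=; last lra; have := IH ltac:(lra); lra.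
have inv1 (k : nat) : / INR k.+1 <= 1.
  by rewrite -Rinv_1; apply: Rinv_le_contravar; rewrite ?S_INR; have := pos_INR k; lra.
have mid (k : nat) : a < INR k -> INR k <= b ->
    psum (step_cost a b c c') k <= a + c * (1 + (ln (INR k) - ln a)).
  elim: k => [|k IH]; first by rewrite /=; lra.
  move=> ak kb; rewrite [psum _ _]/= {2}/step_cost.
  case: (Rle_dec (INR k.+1) a) => [?|?]; first by lra.
  case: (Rle_dec (INR k.+1) b) => [?|?]; last by lra.
  rewrite /is_left /Rdiv; have kS := S_INR k.
  (* If [k] is still at most [a], the new term is the first one past [a]; it is at most [c] and is
     paid for by the summand 1. *)
  have [ka|ka] := Rle_or_lt (INR k) a.
    have := base k ka.
    have h1 : ln a <= ln (INR k.+1) by apply: ln_monotone; lra.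
    have h2 := inv1 k.
    have := Rmult_le_compat_l c (/ INR k.+1) (1 + (ln (INR k.+1) - ln a)) c0 ltac:(lra).
    lra.
  have h := @ln_succ k ltac:(by apply/ltP/INR_lt; rewrite /=; lra).
  have := Rmult_le_compat_l c _ _ c0 h; have := IH ka ltac:(lra); lra.
have top (k : nat) : b < INR k -> psum (step_cost a b c c') k
    <= a + c * (1 + (ln b - ln a)) + c' * (1 + ln (INR k)).
  elim: k => [|k IH]; first by rewrite /=; lra.
  move=> bk; rewrite [psum _ _]/= {2}/step_cost.
  case: (Rle_dec (INR k.+1) a) => [?|?]; first by lra.
  case: (Rle_dec (INR k.+1) b) => [?|?]; first by lra.
  rewrite /is_left /Rdiv; have kS := S_INR k; have k0 := pos_INR k.
  have lnS : 0 <= ln (INR k.+1) by rewrite -ln_1; apply: ln_monotone; lra.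
  have h1 := Rmult_le_compat_l c' (/ INR k.+1) (1 + ln (INR k.+1)) c'0
    ltac:(have := inv1 k; lra).
  (* The predecessor may lie in any of the three ranges; both thresholds are crossed at once when no
     integer lies between them. *)
  have [ka|ka] := Rle_or_lt (INR k) a.
    have := base k ka; have := Rmult_le_pos _ _ c0 lnab; lra.
  have [kb|kb] := Rle_or_lt (INR k) b.
    have h2 : ln (INR k) <= ln b by apply: ln_monotone; lra.
    have := Rmult_le_compat_l c _ _ c0 h2; have := mid k ka kb; lra.
  have h := @ln_succ k ltac:(by apply/ltP/INR_lt; rewrite /=; lra).
  have := Rmult_le_compat_l c' _ _ c'0 h; have := IH kb; lra.
have lnm : 0 <= ln (INR m).
  by rewrite -ln_1; apply: ln_monotone; [lra | exact: (le_INR_leq m0)].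
have clnm := Rmult_le_pos _ _ c'0 lnm; have clnab := Rmult_le_pos _ _ c0 lnab.
have [ma|ma] := Rle_or_lt (INR m) a; first by have := base m ma; lra.
have [mb|mb] := Rle_or_lt (INR m) b; last exact: top.
have h : ln (INR m) <= ln b by apply: ln_monotone; lra.
have := Rmult_le_compat_l c _ _ c0 h; have := mid m ma mb; lra.
Qed.

(** * The degree condition in the two upper ranges *)

Lemma ln_le_self (x : R) : 0 < x -> ln x <= x.
Proof. by move=> x0; have := exp_ineq1_le (ln x); rewrite exp_ln //; lra. Qed.

Lemma ln_pow_le (x : R) (k : nat) : 0 < x -> ln (x ^ k) <= INR k * x.
Proof.
move=> x0; rewrite ln_pow //; apply: Rmult_le_compat_l (pos_INR k) (ln_le_self x0).
Qed.

(* Here n = x ^ 8, lam = |S| / H and d is the degree obtained from pairs at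
   distance at least 1; the ranges meet at lam = x ^ 96 = n ^ 12. *)
Lemma near_step (Q eta x lam d : R) :
  0 < Q -> 0 < eta -> 1 <= x -> 8080 * Q * (1 + eta) <= eta * x ->
  1 + eta <= lam -> lam <= x ^ 96 -> lam <= 1 + d * (2 * Q * (20 / x ^ 4)) ->
  ln (4 / / (x ^ 2 * lam)) <= / (x ^ 2 * lam) * d / 2.
Proof.
move=> Q0 eta0 x1 hx lam1 lam2 hd.
have x2 : 0 < x ^ 2 by apply: pow_lt; lra.
have x4 : 0 < x ^ 4 by apply: pow_lt; lra.
(* The constant is 3 + 2 + 96, from [ln 4 <= 3], [ln (x ^ 2) <= 2 * x] and [ln lam <= 96 * x]. *)
have lnle : ln (4 / / (x ^ 2 * lam)) <= 101 * x.
  rewrite /Rdiv Rinv_inv (ln_mult 4) ?(ln_mult (x ^ 2)); [|lra|lra|lra|nra].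
  have := @ln_pow_le x 2 ltac:(lra); have := @ln_pow_le x 96 ltac:(lra).
  have := @ln_monotone lam (x ^ 96) ltac:(lra) lam2.
  have := exp_ineq1_le (ln 4); rewrite exp_ln; last by lra.
  rewrite !INR_IZR_INZ [Z.of_nat 2]/= [Z.of_nat 96]/=; lra.
apply: Rle_trans lnle _.
have h1 : (lam - 1) * x ^ 4 <= 40 * Q * d.
  have := Rmult_le_compat_r (x ^ 4) _ _ ltac:(lra) hd.
  have -> : (1 + d * (2 * Q * (20 / x ^ 4))) * x ^ 4 = x ^ 4 + 40 * Q * d.
    by field; lra.
  lra.
have h2 : 202 * x ^ 3 * lam <= d.
  (* The margin [eta] enters here: [lam >= 1 + eta] makes [lam - 1] at least the fraction
     [eta / (1 + eta)] of [lam]. The constant 8080 is 40 * 202. *)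
  apply: (Rmult_le_reg_l (40 * Q * (1 + eta))); first by apply: Rmult_lt_0_compat; lra.
  have h3 : lam * eta <= (lam - 1) * (1 + eta) by nra.
  have h4 := Rmult_le_compat_r (x ^ 4) _ _ ltac:(lra) h3.
  have h5 := Rmult_le_compat_r (1 + eta) _ _ ltac:(lra) h1.
  have x3 : 0 < x ^ 3 * lam by apply: Rmult_lt_0_compat; [apply: pow_lt|]; lra.
  have h6 := Rmult_le_compat_r (x ^ 3 * lam) _ _ ltac:(lra) hx.
  have e : eta * x * (x ^ 3 * lam) = lam * eta * x ^ 4 by ring.
  lra.
have xl : 0 < x ^ 2 * lam by nra.
apply: (Rmult_le_reg_l (2 * (x ^ 2 * lam))); first by lra.
have -> : 2 * (x ^ 2 * lam) * (/ (x ^ 2 * lam) * d / 2) = d by field; split; nra.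
have -> : 2 * (x ^ 2 * lam) * (101 * x) = 202 * x ^ 3 * lam by ring.
by [].
Qed.

(* For lam >= n ^ 12 the pairs at distance at most 10 are negligible, and pairs at
   distance at least 11 have balls overlapping in O(V / n ^ 3) words. *)
Lemma far_step (Q L x lam d : R) :
  0 < Q -> 0 <= L -> 1 <= x -> 22 * Q ^ 10 <= x ->
  2 * (4 * Q ^ 11 * 20 ^ 6) * (15 + L) <= x ->
  x ^ 96 <= lam -> ln lam <= x ^ 8 * L ->
  lam <= 11 * (Q * x ^ 8) ^ 10 + d * (2 * Q ^ 11 * (20 / x ^ 4) ^ 6) ->
  ln (4 / / (x ^ 12 * lam)) <= / (x ^ 12 * lam) * d / 2.
Proof.
move=> Q0 L0 x1 hx1 hx2 lam1 lnlam hd.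
have xpos k : 0 < x ^ k by apply: pow_lt; lra.
have xle i j : (i <= j)%N -> x ^ i <= x ^ j.
  by move=> ij; apply: Rle_pow => //; apply/leP.
have lam0 : 0 < lam by have := xpos 96%N; lra.
have lnle : ln (4 / / (x ^ 12 * lam)) <= (15 + L) * x ^ 8.
  have x12 := xpos 12%N.
  rewrite /Rdiv Rinv_inv (ln_mult 4) ?(ln_mult (x ^ 12)) //;
    [|lra|exact: Rmult_lt_0_compat].
  have := @ln_pow_le x 12 ltac:(lra).
  have := exp_ineq1_le (ln 4); rewrite exp_ln; last by lra.
  have := @xle 1%N 8%N isT; have := @xle 0%N 8%N isT.
  rewrite pow_1 pow_O !INR_IZR_INZ [Z.of_nat 12]/=; lra.
apply: Rle_trans lnle _.
set c := 4 * Q ^ 11 * 20 ^ 6 in hx2.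
have c0 : 0 < c by rewrite /c; have := pow_lt Q 11 Q0; lra.
have h1 : lam * x ^ 24 <= c * d.
  (* The near pairs use up at most half of [lam]: by [hx1] they cost at most [x ^ 81 / 2]. *)
  have h2 : 11 * (Q * x ^ 8) ^ 10 <= lam / 2.
    rewrite Rpow_mult_distr -pow_mult.
    have := Rmult_le_compat_r (x ^ 80) _ _ (Rlt_le _ _ (xpos 80%N)) hx1.
    have := @xle 81%N 96%N isT; rewrite (pow_add x 1 80) pow_1 /=; lra.
  have h3 : lam / 2 <= d * (2 * Q ^ 11 * (20 / x ^ 4) ^ 6) by lra.
  have x24 := xpos 24%N.
  have := Rmult_le_compat_r (2 * x ^ 24) _ _ ltac:(lra) h3.
  have -> : (20 / x ^ 4) ^ 6 = 20 ^ 6 / x ^ 24.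
    by rewrite /Rdiv Rpow_mult_distr pow_inv -pow_mult.
  have -> : d * (2 * Q ^ 11 * (20 ^ 6 / x ^ 24)) * (2 * x ^ 24) = c * d.
    by rewrite /c; field; lra.
  lra.
(* The need is [x ^ 20], from [x ^ 12] in the cost and [x ^ 8] in the logarithm. Of the available
   [x ^ 24], one factor [x] absorbs the constants. *)
have h2 : 2 * (15 + L) * x ^ 20 * lam <= d.
  apply: (Rmult_le_reg_l c) => //.
  have x23 : 0 < x ^ 23 * lam by apply: Rmult_lt_0_compat.
  have := Rmult_le_compat_r (x ^ 23 * lam) _ _ ltac:(lra) hx2.
  have -> : x * (x ^ 23 * lam) = lam * x ^ 24 by ring.
  have x2023 : x ^ 20 * lam <= x ^ 23 * lam.
    by apply: Rmult_le_compat_r; [lra | exact: xle].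
  have := Rmult_le_compat_l (2 * c * (15 + L)) _ _ ltac:(nra) x2023.
  lra.
have xl : 0 < x ^ 12 * lam by apply: Rmult_lt_0_compat.
apply: (Rmult_le_reg_l (2 * (x ^ 12 * lam))); first by lra.
have -> : 2 * (x ^ 12 * lam) * (/ (x ^ 12 * lam) * d / 2) = d.
  by field; have := xpos 12%N; split; lra.
have -> : 2 * (x ^ 12 * lam) * ((15 + L) * x ^ 8) = 2 * (15 + L) * x ^ 20 * lam by ring.
by [].
Qed.

(** * Application to codes *)

Lemma vol_gt0 (q n t : nat) : (0 < vol q n t.+1)%N.
Proof. by rewrite /vol big_ord_recl bin0 expn0. Qed.

Lemma vol_le_words (q n t : nat) : (0 < q)%N -> (vol q n t <= q ^ n)%N.
Proof.
case: q => // q _; have x : word q.+1 n := [ffun => ord0].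
by rewrite -(card_ball t x) -card_word max_card.
Qed.

Lemma HboundE (q n t : nat) : Hbound q n t = INR q ^ n / INR (vol q n t.+1).
Proof. by rewrite /Hbound pow_expn INR_expn VballE. Qed.

Lemma vol_shrink_real (q n t k : nat) (x : R) : (1 < q)%N -> 3 <= x ->
  INR n = x ^ 8 -> INR t <= 10 * x ^ 4 ->
  INR (vol q n (t.+1 - k)) <= (20 / x ^ 4) ^ k * INR (vol q n t.+1).
Proof.
move=> q1 x3 nx tx.
have x4 : 0 < x ^ 4 by apply: pow_lt; lra.
(* From [x >= 3] comes [x ^ 4 >= 81], hence [t <= 10 * x ^ 4 <= n / 2]. *)
have nt : x ^ 8 / 2 <= INR (n - t).
  have := @le_INR_leq n ((n - t) + t)%N ltac:(lia); rewrite INR_addn nx.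
  have : 3 ^ 4 <= x ^ 4 by apply: pow_incr; lra.
  have -> : x ^ 8 = x ^ 4 * x ^ 4 by ring.
  by nra.
have x8 : 0 < x ^ 8 / 2 by have : 0 < x ^ 8 by [apply: pow_lt; lra]; lra.
have := le_INR_leq (vol_shrink n t k q1); rewrite !INR_muln !INR_expn => h.
have xk : 0 < (x ^ 8 / 2) ^ k by exact: pow_lt.
apply: (Rmult_le_reg_r ((x ^ 8 / 2) ^ k)) => //.
apply: Rle_trans (_ : INR (vol q n (t.+1 - k)) * INR (n - t) ^ k <= _).
  by apply: Rmult_le_compat_l (pos_INR _) _; apply: pow_incr; lra.
apply: Rle_trans h _.
have -> : (20 / x ^ 4) ^ k * INR (vol q n t.+1) * (x ^ 8 / 2) ^ k
          = (10 * x ^ 4) ^ k * INR (vol q n t.+1).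
  rewrite Rmult_assoc (Rmult_comm _ ((x ^ 8 / 2) ^ k)) -Rmult_assoc -Rpow_mult_distr.
  by congr (_ ^ _ * _); field; lra.
apply: Rmult_le_compat_r (pos_INR _) _; apply: pow_incr; split=> //; exact: pos_INR.
Qed.

Definition far_apart (q n t : nat) : rel (word q n) :=
  fun x y => (2 * t + 1 <= hamming x y)%N.

Lemma many_conflicts (q n t k : nat) (x : R) (S : {set word q n}) :
  (1 < q)%N -> (0 < k)%N -> 3 <= x -> INR n = x ^ 8 -> INR t <= 10 * x ^ 4 ->
  S != set0 ->
  exists2 v, v \in S &
    INR #|S| / Hbound q n t <= INR (vol q n (2 * k - 1))
      + INR #|conflicts (@far_apart q n t) S v|
        * (2 * INR q ^ (2 * k - 1) * (20 / x ^ 4) ^ k).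
Proof.
move=> q1 k0 x3 nx tx S0.
have [v vS h] := @supersaturation q n t k S k0 S0; exists v => //.
have := le_INR_leq h.
rewrite !(INR_muln, INR_addn, INR_expn) -/(conflicts (@far_apart q n t) S v).
have -> : #|[set y in S | (y != v) && ~~ (2 * t + 1 <= hamming v y)%N]|
          = #|conflicts (@far_apart q n t) S v| by [].
have W := vol_shrink_real k q1 x3 nx tx.
rewrite HboundE.
have V0 : 0 < INR (vol q n t.+1) by apply: lt_0_INR; apply/ltP; exact: vol_gt0.
have q0 : 0 < INR q by apply: lt_0_INR; apply/ltP; lia.
have qn : 0 < INR q ^ n by exact: pow_lt.
have qk : 0 < INR q ^ (2 * k - 1) by exact: pow_lt.
move: (INR #|S|) (INR (vol q n (2 * k - 1))) (pos_INR #|conflicts (@far_apart q n t) S v|)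
  => s v0 d0 hs.
apply: (Rmult_le_reg_l (INR q ^ n * INR (vol q n t.+1))); first by nra.
have -> : INR q ^ n * INR (vol q n t.+1) * (s / (INR q ^ n / INR (vol q n t.+1)))
          = s * INR (vol q n t.+1) ^ 2 by field; lra.
apply: Rle_trans hs _; rewrite [X in _ <= X]Rmult_assoc; apply: Rmult_le_compat_l; first by lra.
have c0 : 0 <= INR #|conflicts (@far_apart q n t) S v| * (2 * INR q ^ (2 * k - 1)).
  by apply: Rmult_le_pos; lra.
have := Rmult_le_compat_l _ _ _ c0 W; rewrite -[INR 2]/(1 + 1); lra.
Qed.

(** With [x = n ^ (1/8)], the numerical hypotheses say that [x] is large in terms of [q] and [eta].
    One [eta] pays for the first range, of length [(1 + eta) H], the other for the two harmonic
    sums, which are O(H / x). *)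
Lemma num_codes_bound (q n t : nat) (x eta : R) :
  (1 < q)%N -> INR n = x ^ 8 -> INR t <= 10 * x ^ 4 -> 0 < eta -> 3 <= x ->
  1 + eta <= x -> 8080 * INR q * (1 + eta) <= eta * x -> 22 * INR q ^ 10 <= x ->
  2 * (4 * INR q ^ 11 * 20 ^ 6) * (15 + ln (INR q)) <= x ->
  98 + ln (INR q) <= eta * x ->
  INR (num_codes q n t) <= Rpower 2 ((1 + 2 * eta) * Hbound q n t).
Proof.
move=> q1 nx tx eta0 x3 hx0 hx1 hx2 hx3 hx4.
have q1' : 1 < INR q by rewrite -[1]/(INR 1); apply: lt_INR; apply/ltP.
set H := Hbound q n t; set L := ln (INR q) in hx3 hx4.
have L0 : 0 <= L by rewrite /L -ln_1; apply: ln_monotone; lra.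
have V1 : 1 <= INR (vol q n t.+1) := le_INR_leq (vol_gt0 q n t).
have VQ : INR (vol q n t.+1) <= INR q ^ n.
  by rewrite -INR_expn; apply: le_INR_leq; apply: vol_le_words; lia.
have HE : H * INR (vol q n t.+1) = INR q ^ n by rewrite /H HboundE; field; lra.
have H1 : 1 <= H.
  by apply: (Rmult_le_reg_r (INR (vol q n t.+1))); lra.
have qnH : INR q ^ n <= INR q ^ n * H by nra.
have xpos k : 0 < x ^ k by apply: pow_lt; lra.
have xle i j : (i <= j)%N -> x ^ i <= x ^ j.
  by move=> ij; apply: Rle_pow; [lra | apply/leP].
have lnqn : ln (INR q ^ n) = x ^ 8 * L by rewrite ln_pow ?nx //; lra.
pose a := (1 + eta) * H; pose b := x ^ 96 * H.
pose c := H / x ^ 2; pose c' := H / x ^ 12.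
have ab : 0 < a <= b.
  rewrite /a /b; split; first by apply: Rmult_lt_0_compat; lra.
  by apply: Rmult_le_compat_r; [lra | have := xle 1%N 96%N isT; rewrite pow_1; lra].
have c'0 : 0 < c' by apply: Rdiv_lt_0_compat; [lra | exact: xpos].
have c'c : 0 <= c' <= c.
  split; first by lra.
  rewrite /c' /c /Rdiv.
  apply: Rmult_le_compat_l; first by lra.
  by apply: Rinv_le_contravar => //; exact: xle.
have ca : c <= a.
  apply: Rle_trans (_ : H <= _); last by rewrite /a; nra.
  apply: (Rmult_le_reg_r (x ^ 2)) => //.
  have -> : c * x ^ 2 = H by rewrite /c; field; lra.
  have := xle 0%N 2%N isT; rewrite pow_O; nra.
have e : num_codes q n t = #|indep_in (@far_apart q n t) setT|.
  by apply: eq_card => C; rewrite !inE subsetT.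
rewrite e; apply: Rle_trans (card_indep_in_le (step_cost_anti c'c ca (proj2 ab)) _ _) _.
  move=> A A0; set m := INR #|A|.
  have m1 : 1 <= m by rewrite -[1]/(INR 1); apply: le_INR_leq; rewrite card_gt0.
  have lamE : m = m / H * H by field; lra.
  have mQ : m / H <= INR q ^ n.
    apply: (Rmult_le_reg_r H); first by lra.
    rewrite -lamE; apply: Rle_trans qnH.
    rewrite -INR_expn -card_word; apply: le_INR_leq; exact: max_card.
  have small k : H / x ^ k / m = / (x ^ k * (m / H)).
    by field; have := xpos k; lra.
  have unit_cost u : 0 < u <= a -> a < m -> 0 < u / m <= 1.
    move=> ua am; split; first by apply: Rdiv_lt_0_compat; lra.
    apply: (Rmult_le_reg_r m); first by lra.
    by rewrite /Rdiv Rmult_assoc Rinv_l; lra.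
  rewrite /step_cost -/m; case: (Rle_dec m a) => [ma|ma] /=.
    (* With cost 1 any word will do: even without conflicts the two powers are 1/2 each. *)
    have [v vA] := set0Pn _ A0; exists v => //.
    rewrite !Rpower_Ropp Rpower_1; last by lra.
    have h : 2 <= Rpower 2 (1 * (INR #|conflicts (@far_apart q n t) A v| + 1)).
      rewrite -[X in X <= _](Rpower_1 2); last by lra.
      by apply: Rle_Rpower; have := pos_INR #|conflicts (@far_apart q n t) A v|; lra.
    apply: Rle_trans (_ : / 2 + / 2 <= 1); last by lra.
    by apply: Rplus_le_compat_l; apply: Rinv_le_contravar h; lra.
  have lam1 : 1 + eta <= m / H.
    apply: (Rmult_le_reg_r H); first by lra.
    by rewrite -lamE; rewrite /a in ma; lra.
  case: (Rle_dec m b) => [mb|mb] /=.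
    have [v vA hv] := many_conflicts (k := 1) q1 isT x3 nx tx A0.
    exists v => //; apply: Rpower2_step.
    - by apply: unit_cost; lra.
    - exact: pos_INR.
    - rewrite /c small.
      apply: near_step hx1 lam1 _ _; try lra.
        apply: (Rmult_le_reg_r H); first by lra.
        by rewrite -lamE.
      apply: Rle_trans hv _; rewrite !pow_1.
      (* For [k = 1] the only near word is the centre itself. *)
      have -> : vol q n (2 * 1 - 1) = 1%N by rewrite /vol big_ord1 bin0.
      by rewrite /=; lra.
  have [v vA hv] := many_conflicts (k := 6) q1 isT x3 nx tx A0.
  exists v => //; apply: Rpower2_step.
  - by apply: unit_cost; lra.
  - exact: pos_INR.
  - rewrite /c' small.
    apply: (far_step (L := L) (Q := INR q)) => //; try lra.
    + by apply: (Rmult_le_reg_r H); [lra | rewrite -lamE -/b; lra].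
    + by rewrite -lnqn; apply: ln_monotone => //; lra.
    + apply: Rle_trans hv _; apply: Rplus_le_compat_r.
      have n0 : (0 < n)%N by apply/ltP/INR_lt; rewrite nx; exact: xpos.
      have := le_INR_leq (@vol_le q n 10 ltac:(lia) n0).
      rewrite !(INR_muln, INR_expn) nx (_ : INR 11 = 11) //.
      by rewrite INR_IZR_INZ.
apply: Rle_Rpower; first by lra.
have Q0 : (0 < #|[set: word q n]|)%N.
  by rewrite cardsT card_word expn_gt0; apply/orP; left; lia.
apply: Rle_trans (psum_step_cost ab _ _ Q0) _; try lra.
have -> : INR #|[set: word q n]| = INR q ^ n by rewrite cardsT card_word INR_expn.
rewrite lnqn.
(* As [H <= a], the ratio of [b] to [a] is at most [x ^ 96]. *)
have lnab : ln b - ln a <= 96 * x.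
  have : ln H <= ln a by apply: ln_monotone; rewrite /a; nra.
  have := @ln_pow_le x 96 ltac:(lra); rewrite (INR_IZR_INZ 96) [Z.of_nat 96]/=.
  rewrite /b ln_mult //; lra.
have cb : c * (1 + (ln b - ln a)) <= 97 / x * H.
  apply: Rle_trans (_ : c * (97 * x) <= _); first by apply: Rmult_le_compat_l; lra.
  have -> : c * (97 * x) = 97 / x * H by rewrite /c; field; lra.
  lra.
have cb' : c' * (1 + x ^ 8 * L) <= (1 + L) / x * H.
  apply: Rle_trans (_ : c' * ((1 + L) * x ^ 11) <= _).
    apply: Rmult_le_compat_l; first by lra.
    have := xle 0%N 11%N isT; have := Rmult_le_compat_r L _ _ L0 (xle 8%N 11%N isT).
    rewrite pow_O; lra.
  have -> : c' * ((1 + L) * x ^ 11) = (1 + L) / x * H by rewrite /c'; field; lra.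
  lra.
have h : 97 / x + (1 + L) / x <= eta.
  apply: (Rmult_le_reg_r x); first by lra.
  have -> : (97 / x + (1 + L) / x) * x = 98 + L by field; lra.
  lra.
have := Rmult_le_compat_r H _ _ ltac:(lra) h; have aE : a = (1 + eta) * H by []; lra.
Qed.

Theorem theorem1p1 (q : nat) (hq : (2 <= q)%N) (t : nat -> nat)
  (ht_pos : forall n : nat, (0 < n)%N -> (0 < t n)%N)
  (ht_le : forall n : nat, (0 < n)%N -> (INR (t n) <= 10 * sqrt (INR n))%R) :
  forall eps : R, (0 < eps)%R ->
  exists N : nat, forall n : nat, (N <= n)%N ->
    (INR (num_codes q n (t n)) <= Rpower 2 ((1 + eps) * Hbound q n (t n)))%R.
Proof.
move=> eps eps0; set eta := eps / 2; have eta0 : 0 < eta by rewrite /eta; lra.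
have q1 : 1 < INR q by rewrite -[1]/(INR 1); apply: lt_INR; apply/ltP.
have L0 : 0 <= ln (INR q) by rewrite -ln_1; apply: ln_monotone; lra.
have q10 := pow_lt (INR q) 10 ltac:(lra); have q11 := pow_lt (INR q) 11 ltac:(lra).
pose K1 := 8080 * INR q * (1 + eta) / eta; pose K2 := 22 * INR q ^ 10.
pose K3 := 2 * (4 * INR q ^ 11 * 20 ^ 6) * (15 + ln (INR q)).
pose K4 := (98 + ln (INR q)) / eta.
have K1p : 0 < K1 by apply: Rdiv_lt_0_compat => //; apply: Rmult_lt_0_compat; lra.
have K2p : 0 < K2 by rewrite /K2; lra.
have K3p : 0 < K3 by apply: Rmult_lt_0_compat; lra.
have K4p : 0 < K4 by apply: Rdiv_lt_0_compat => //; lra.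
(* Each summand is positive, so [x >= X] gives every lower bound on [x] that [num_codes_bound]
   requires. *)
pose X := 3 + eta + K1 + K2 + K3 + K4.
have [N hN] := INR_unbounded (X ^ 8).
exists N => n Nn.
have nX : X ^ 8 < INR n by have := le_INR_leq Nn; lra.
have X0 : 0 < X by rewrite /X; lra.
have n0 : 0 < INR n by have := pow_lt X 8 X0; lra.
pose x := sqrt (sqrt (sqrt (INR n))).
have x0 : 0 <= x by exact: sqrt_pos.
have x4 : x ^ 4 = sqrt (INR n).
  have -> : x ^ 4 = (x ^ 2) ^ 2 by ring.
  by rewrite /x !pow2_sqrt //; exact: sqrt_pos.
have x8 : x ^ 8 = INR n.
  have -> : x ^ 8 = (x ^ 4) ^ 2 by ring.
  by rewrite x4 pow2_sqrt //; lra.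
have Xx : X <= x.
  apply: Rnot_lt_le => xX.
  by have := pow_incr x X 8 ltac:(lra); lra.
have -> : 1 + eps = 1 + 2 * eta by rewrite /eta; field.
have n0' : (0 < n)%N by apply/ltP/INR_lt.
apply: (@num_codes_bound q n (t n) x eta) => //.
- by rewrite x4; exact: ht_le.
- by rewrite /X in Xx; lra.
- by rewrite /X in Xx; lra.
- have -> : 8080 * INR q * (1 + eta) = eta * K1 by rewrite /K1; field; lra.
  by apply: Rmult_le_compat_l; [lra | rewrite /X in Xx; lra].
- by rewrite -/K2; rewrite /X in Xx; lra.
- by rewrite -/K3; rewrite /X in Xx; lra.
- have -> : 98 + ln (INR q) = eta * K4 by rewrite /K4; field; lra.
  by apply: Rmult_le_compat_l; [lra | rewrite /X in Xx; lra].
Qed.
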